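(* The functor $G$ from $\mathbf{L}_{\bot}$ to $\mathit{Rel}$ is faithful; that is, for all arrow terms $f,g:A\vdash B$ of $\mathbf{L}_{\bot}$ of the same type, if $Gf=Gg$ then $f=g$ in $\mathbf{L}_{\bot}$.
   Context: Formulae: the objects of $\mathbf{L}_{\bot}$ are the formulae built from infinitely many propositional letters and the propositional constant $\bot$ with the binary connectives $\wedge$ and $\vee$; $\xi$ stands for either $\wedge$ or $\vee$. The category $\mathbf{L}_{\bot}$: arrow terms are typed expressions, where $f:A\vdash B$ means that $f$ has source $A$ and target $B$. For all formulae $A,A_1,A_2$ and $i\in\{1,2\}$ the primitive arrow terms are $\mathbf{1}_A:A\vdash A$, $\hat w_A:A\vdash A\wedge A$, $\check w_A:A\vee A\vdash A$, $\hat k^i_{A_1,A_2}:A_1\wedge A_2\vdash A_i$, $\check k^i_{A_1,A_2}:A_i\vdash A_1\vee A_2$, $\check\kappa_A:\bot\vdash A$. If $f:A\vdash B$ and $g:B\vdash C$ are arrow terms, so is $g\circ f:A\vdash C$; if $f_j:A_j\vdash B_j$ ($j=1,2$) are arrow terms, so is $f_1\mathbin{\xi}f_2:A_1\mathbin{\xi}A_2\vdash B_1\mathbin{\xi}B_2$. The equations of $\mathbf{L}_{\bot}$ are the smallest set of equations between arrow terms of the same type that contains all instances of $f=f$ and of the following, and is closed under symmetry, transitivity and congruence with respect to $\circ$, $\wedge$ and $\vee$ on arrow terms: categorial: $f\circ\mathbf{1}_A=\mathbf{1}_B\circ f=f$ for $f:A\vdash B$, $h\circ(g\circ f)=(h\circ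 g)\circ f$; bifunctorial: $\mathbf{1}_A\mathbin{\xi}\mathbf{1}_B=\mathbf{1}_{A\xi B}$, $(g_1\circ f_1)\mathbin{\xi}(g_2\circ f_2)=(g_1\mathbin{\xi}g_2)\circ(f_1\mathbin{\xi}f_2)$; naturality (for $f:A\vdash B$, $f_j:A_j\vdash B_j$): $(f\wedge f)\circ\hat w_A=\hat w_B\circ f$, $f\circ\check w_A=\check w_B\circ(f\vee f)$, $f_i\circ\hat k^i_{A_1,A_2}=\hat k^i_{B_1,B_2}\circ(f_1\wedge f_2)$, $(f_1\vee f_2)\circ\check k^i_{A_1,A_2}=\check k^i_{B_1,B_2}\circ f_i$; triangular: $\hat k^i_{A,A}\circ\hat w_A=\mathbf{1}_A$, $\check w_A\circ\check k^i_{A,A}=\mathbf{1}_A$, $(\hat k^1_{A,B}\wedge\hat k^2_{A,B})\circ\hat w_{A\wedge B}=\mathbf{1}_{A\wedge B}$, $\check w_{A\vee B}\circ(\check k^1_{A,B}\vee\check k^2_{A,B})=\mathbf{1}_{A\vee B}$; initial: $\check\kappa_A=g$ for every $g:\bot\vdash A$; and $\hat k^1_{\bot,\bot}=\hat k^2_{\bot,\bot}$. Arrows of $\mathbf{L}_{\bot}$ are equivalence classes of arrow terms modulo these equations. The category $\mathit{Rel}$ and the functor $G$: objects of $\mathit{Rel}$ are the formulae built from propositional letters, $\top$ and $\bot$ with $\wedge$ and $\vee$; an arrow $R:A\vdash B$ is a binary relation from the set of occurrences of propositional letters in $A$ to the set of occurrences of propositional letters in $B$ (constants are not letters); composition is $R_2\circ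 R_1=\{(x,y)\mid\exists z\,(xR_1z\text{ and }zR_2y)\}$, identities are identity relations. Let $|A|$ be the number of letter occurrences in $A$ and $x_j(A)$ the $j$-th one from the left. $R_1\mathbin{\xi}R_2$ is the disjoint union of $R_1$ and $R_2$ placed side by side: it consists of the pairs $(x_j(A_1\xi A_2),x_k(B_1\xi B_2))$ with $(x_j(A_1),x_k(B_1))\in R_1$ and $(x_{j+|A_1|}(A_1\xi A_2),x_{k+|B_1|}(B_1\xi B_2))$ with $(x_j(A_2),x_k(B_2))\in R_2$. The functor $G:\mathbf{L}_{\bot}\to\mathit{Rel}$ is the identity on objects, preserves identities, $\circ$, $\wedge$, $\vee$, and satisfies: $(x_j(A),x_k(A\wedge A))\in G\hat w_A$ iff $(x_k(A\vee A),x_j(A))\in G\check w_A$ iff $j\equiv k\pmod{|A|}$; $(x_j(A_1\wedge A_2),x_k(A_1))\in G\hat k^1_{A_1,A_2}$ iff $(x_k(A_1),x_j(A_1\vee A_2))\in G\check k^1_{A_1,A_2}$ iff $j=k$; $(x_j(A_1\wedge A_2),x_k(A_2))\in G\hat k^2_{A_1,A_2}$ iff $(x_k(A_2),x_j(A_1\vee A_2))\in G\check k^2_{A_1,A_2}$ iff $j=k+|A_1|$; and $G\check\kappa_A=\emptyset$. *)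

(* Defs.v *)
From mathcomp Require Import all_boot.

Set Implicit Arguments.
Unset Strict Implicit.
Unset Printing Implicit Defensive.

Inductive connective := Conj | Disj.

Inductive formula : Type :=
  | Letter of nat
  | Bot
  | Bin of connective & formula & formula.

Declare Scope lbot_scope.
Delimit Scope lbot_scope with L.
Local Open Scope lbot_scope.

Notation "A ∧ B" := (Bin Conj A B) (at level 40, left associativity) : lbot_scope.
Notation "A ∨ B" := (Bin Disj A B) (at level 40, left associativity) : lbot_scope.

Reserved Notation "A ⊢ B" (at level 65, no associativity).

(* [bint xi f1 f2] is the arrow term f1 ξ f2, with ξ either ∧ or ∨.           *)
Inductive term : formula -> formula -> Type :=
  | idt A : A ⊢ A
  | hat_w A : A ⊢ A ∧ A
  | check_w A : A ∨ A ⊢ A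
  | hat_k1 A1 A2 : A1 ∧ A2 ⊢ A1
  | hat_k2 A1 A2 : A1 ∧ A2 ⊢ A2
  | check_k1 A1 A2 : A1 ⊢ A1 ∨ A2
  | check_k2 A1 A2 : A2 ⊢ A1 ∨ A2
  | check_kappa A : Bot ⊢ A
  | compt A B C (g : B ⊢ C) (f : A ⊢ B) : A ⊢ C
  | bint (xi : connective) A1 A2 B1 B2 (f1 : A1 ⊢ B1) (f2 : A2 ⊢ B2) :
      Bin xi A1 A2 ⊢ Bin xi B1 B2
where "A ⊢ B" := (term A B) : lbot_scope.

Arguments idt A : clear implicits.
Arguments hat_w A : clear implicits.
Arguments check_w A : clear implicits.
Arguments hat_k1 A1 A2 : clear implicits.
Arguments hat_k2 A1 A2 : clear implicits.
Arguments check_k1 A1 A2 : clear implicits.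
Arguments check_k2 A1 A2 : clear implicits.
Arguments check_kappa A : clear implicits.
Arguments compt {A B C} g f.
Arguments bint xi {A1 A2 B1 B2} f1 f2.

Notation "g ∘ f" := (compt g f) (at level 50, left associativity) : lbot_scope.

Reserved Notation "f ≡ g" (at level 70, no associativity).

(* [f ≡ g] means that f = g is an equation of L_bot, that is, that the arrow  *)
(* terms f and g denote the same arrow.                                       *)
Inductive eqL : forall A B, A ⊢ B -> A ⊢ B -> Prop :=
  | eqL_refl A B (f : A ⊢ B) : f ≡ f
  | eqL_sym A B (f g : A ⊢ B) : f ≡ g -> g ≡ f
  | eqL_trans A B (f g h : A ⊢ B) : f ≡ g -> g ≡ h -> f ≡ h
  | eqL_comp A B C (g g' : B ⊢ C) (f f' : A ⊢ B) :
      g ≡ g' -> f ≡ f' -> g ∘ f ≡ g' ∘ f'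
  | eqL_par xi A1 A2 B1 B2 (f1 f1' : A1 ⊢ B1) (f2 f2' : A2 ⊢ B2) :
      f1 ≡ f1' -> f2 ≡ f2' -> bint xi f1 f2 ≡ bint xi f1' f2'
  | cat_idr A B (f : A ⊢ B) : f ∘ idt A ≡ f
  | cat_idl A B (f : A ⊢ B) : idt B ∘ f ≡ f
  | cat_assoc A B C D (f : A ⊢ B) (g : B ⊢ C) (h : C ⊢ D) :
      h ∘ (g ∘ f) ≡ (h ∘ g) ∘ f
  | bif_id xi A B : bint xi (idt A) (idt B) ≡ idt (Bin xi A B)
  | bif_comp xi A1 A2 B1 B2 C1 C2 (f1 : A1 ⊢ B1) (g1 : B1 ⊢ C1)
      (f2 : A2 ⊢ B2) (g2 : B2 ⊢ C2) :
      bint xi (g1 ∘ f1) (g2 ∘ f2) ≡ bint xi g1 g2 ∘ bint xi f1 f2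
  | nat_hat_w A B (f : A ⊢ B) : bint Conj f f ∘ hat_w A ≡ hat_w B ∘ f
  | nat_check_w A B (f : A ⊢ B) : f ∘ check_w A ≡ check_w B ∘ bint Disj f f
  | nat_hat_k1 A1 A2 B1 B2 (f1 : A1 ⊢ B1) (f2 : A2 ⊢ B2) :
      f1 ∘ hat_k1 A1 A2 ≡ hat_k1 B1 B2 ∘ bint Conj f1 f2
  | nat_hat_k2 A1 A2 B1 B2 (f1 : A1 ⊢ B1) (f2 : A2 ⊢ B2) :
      f2 ∘ hat_k2 A1 A2 ≡ hat_k2 B1 B2 ∘ bint Conj f1 f2
  | nat_check_k1 A1 A2 B1 B2 (f1 : A1 ⊢ B1) (f2 : A2 ⊢ B2) :
      bint Disj f1 f2 ∘ check_k1 A1 A2 ≡ check_k1 B1 B2 ∘ f1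
  | nat_check_k2 A1 A2 B1 B2 (f1 : A1 ⊢ B1) (f2 : A2 ⊢ B2) :
      bint Disj f1 f2 ∘ check_k2 A1 A2 ≡ check_k2 B1 B2 ∘ f2
  | tri_hat_k1 A : hat_k1 A A ∘ hat_w A ≡ idt A
  | tri_hat_k2 A : hat_k2 A A ∘ hat_w A ≡ idt A
  | tri_check_k1 A : check_w A ∘ check_k1 A A ≡ idt A
  | tri_check_k2 A : check_w A ∘ check_k2 A A ≡ idt A
  | tri_hat_w A B :
      bint Conj (hat_k1 A B) (hat_k2 A B) ∘ hat_w (A ∧ B) ≡ idt (A ∧ B)
  | tri_check_w A B :
      check_w (A ∨ B) ∘ bint Disj (check_k1 A B) (check_k2 A B) ≡ idt (A ∨ B)
  | initial A (g : Bot ⊢ A) : check_kappa A ≡ g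
  | hat_k_bot : hat_k1 Bot Bot ≡ hat_k2 Bot Bot
where "f ≡ g" := (eqL f g) : lbot_scope.

(* Formulae of Rel, with both constants; L_bot has only the ⊤-free ones.      *)
Inductive rformula : Type :=
  | RLetter of nat
  | RTop
  | RBot
  | RBin of connective & rformula & rformula.

Fixpoint letters (A : rformula) : nat :=
  match A with
  | RLetter _ => 1
  | RTop | RBot => 0
  | RBin _ A1 A2 => letters A1 + letters A2
  end.

(* The ordinal j : 'I_(letters A) stands for the letter occurrence            *)
(* x_(j+1)(A), the (j+1)-th one from the left.                                *)
Notation occ A := 'I_(letters A).

Definition arrow (A B : rformula) : Type := {set occ A * occ B}.

Definition rel_id A : arrow A A := [set p | p.1 == p.2].

Definition rel_comp A B C (R2 : arrow B C) (R1 : arrow A B) : arrow A C :=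
  [set p | [exists z, ((p.1, z) \in R1) && ((z, p.2) \in R2)]].

Definition rel_par xi A1 A2 B1 B2 (R1 : arrow A1 B1) (R2 : arrow A2 B2) :
    arrow (RBin xi A1 A2) (RBin xi B1 B2) :=
  [set (lshift (letters A2) p.1, lshift (letters B2) p.2) | p in R1] :|:
  [set (rshift (letters A1) p.1, rshift (letters B1) p.2) | p in R2].

(* Inclusion of the formulae of L_bot in those of Rel: G is the identity on   *)
(* objects.                                                                   *)
Fixpoint Gobj (A : formula) : rformula :=
  match A with
  | Letter n => RLetter n
  | Bot => RBot
  | Bin xi A1 A2 => RBin xi (Gobj A1) (Gobj A2)
  end.

(* The conditions on indices below are unaffected by counting from 0.         *)
Fixpoint G A B (f : A ⊢ B) : arrow (Gobj A) (Gobj B) :=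
  match f in A ⊢ B return arrow (Gobj A) (Gobj B) with
  | idt A => rel_id (Gobj A)
  | hat_w A =>
      [set p : occ (Gobj A) * occ (Gobj (A ∧ A))
         | p.1 == p.2 %[mod letters (Gobj A)]]
  | check_w A =>
      [set p : occ (Gobj (A ∨ A)) * occ (Gobj A)
         | p.1 == p.2 %[mod letters (Gobj A)]]
  | hat_k1 A1 A2 =>
      [set p : occ (Gobj (A1 ∧ A2)) * occ (Gobj A1) | p.1 == p.2 :> nat]
  | hat_k2 A1 A2 =>
      [set p : occ (Gobj (A1 ∧ A2)) * occ (Gobj A2)
         | p.1 == p.2 + letters (Gobj A1) :> nat]
  | check_k1 A1 A2 =>
      [set p : occ (Gobj A1) * occ (Gobj (A1 ∨ A2)) | p.2 == p.1 :> nat]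
  | check_k2 A1 A2 =>
      [set p : occ (Gobj A2) * occ (Gobj (A1 ∨ A2))
         | p.2 == p.1 + letters (Gobj A1) :> nat]
  | check_kappa A => set0
  | compt A B C g f => rel_comp (G g) (G f)
  | bint xi A1 A2 B1 B2 f1 f2 => rel_par xi (G f1) (G f2)
  end.

(* Main.v *)
Require Import Defs.
From mathcomp Require Import all_boot.
From Stdlib Require Import Setoid Morphisms.

Set Implicit Arguments.
Unset Strict Implicit.
Unset Printing Implicit Defensive.

Local Open Scope lbot_scope.

(** The formulae and arrows form the free category with binary products, binary
    coproducts and an initial object, subject to the equality of the two
    projections of Bot ∧ Bot.  Every arrow has a cut-free form
    ([cut_elimination]): unless its source is a disjunction or its target a
    conjunction, in which case it is determined by two arrows with a smaller
    source or target, it is a letter identity, an arrow out of Bot, an arrow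
    precomposed with a projection or an arrow postcomposed with an injection.

    Induction on source and target then reduces faithfulness to a conflict of
    last rules between two arrows from A to B with the same relation.

    If one of them is an injection into B1 ∨ B2 after some arrow, its relation
    lands in a single disjunct.  By [factors_through_injection] this forces the
    other arrow, whatever its last rule, to factor through the same injection,
    and the injection can be cancelled in the relations.

    If both are preceded by projections from A1 ∧ A2, either these agree and can
    be cancelled, or the common relation starts in A1 and in A2, so it is empty.

    What remains is to see that an arrow with an empty relation is unique.  It
    factors through Bot ([empty_factors]), and Bot receives at most one arrow
    from each formula ([bot_subterminal]); this last fact is where the equality
    of the two projections of Bot ∧ Bot enters. *)

(** * Products, coproducts and the initial object *)

#[local] Instance eqL_equivalence A B : Equivalence (@eqL A B).
Proof.
split; [exact: eqL_refl | exact: eqL_sym | exact: eqL_trans].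
Qed.

#[local] Hint Resolve eqL_refl : core.

#[local] Instance compt_proper A B C :
  Proper (@eqL B C ==> @eqL A B ==> @eqL A C) compt.
Proof. by move=> g g' eg f f' ef; apply: eqL_comp. Qed.

#[local] Instance bint_proper xi A1 A2 B1 B2 :
  Proper (@eqL A1 B1 ==> @eqL A2 B2 ==> @eqL _ _) (@bint xi A1 A2 B1 B2).
Proof. by move=> f f' ef g g' eg; apply: eqL_par. Qed.

(** Projections and injections indexed by a side, [true] being the right one, so
    that both sides share one proof. *)
Definition pick (i : bool) (A1 A2 : formula) := if i then A2 else A1.

Definition hat_k i A1 A2 : A1 ∧ A2 ⊢ pick i A1 A2 :=
  if i return A1 ∧ A2 ⊢ pick i A1 A2 then hat_k2 A1 A2 else hat_k1 A1 A2.

Definition check_k i A1 A2 : pick i A1 A2 ⊢ A1 ∨ A2 :=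
  if i return pick i A1 A2 ⊢ A1 ∨ A2 then check_k2 A1 A2 else check_k1 A1 A2.

Arguments hat_k i {A1 A2}.
Arguments check_k i {A1 A2}.

Definition copair A1 A2 C (f1 : A1 ⊢ C) (f2 : A2 ⊢ C) : A1 ∨ A2 ⊢ C :=
  check_w C ∘ bint Disj f1 f2.

Lemma copair_k1 A1 A2 C (f1 : A1 ⊢ C) (f2 : A2 ⊢ C) :
  copair f1 f2 ∘ check_k1 A1 A2 ≡ f1.
Proof.
by rewrite /copair -cat_assoc nat_check_k1 cat_assoc tri_check_k1 cat_idl.
Qed.

Lemma copair_k2 A1 A2 C (f1 : A1 ⊢ C) (f2 : A2 ⊢ C) :
  copair f1 f2 ∘ check_k2 A1 A2 ≡ f2.
Proof.
by rewrite /copair -cat_assoc nat_check_k2 cat_assoc tri_check_k2 cat_idl.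
Qed.

Lemma hat_k_monic A B1 B2 (f g : A ⊢ B1 ∧ B2) :
  (forall i, hat_k i ∘ f ≡ hat_k i ∘ g) -> f ≡ g.
Proof.
have eta (h : A ⊢ B1 ∧ B2) :
    h ≡ bint Conj (hat_k1 B1 B2 ∘ h) (hat_k2 B1 B2 ∘ h) ∘ hat_w A.
  by rewrite bif_comp -cat_assoc nat_hat_w cat_assoc tri_hat_w cat_idl.
move=> efg; rewrite (eta f) (eta g).
by rewrite (efg false : hat_k1 _ _ ∘ f ≡ _) (efg true : hat_k2 _ _ ∘ f ≡ _).
Qed.

Lemma check_k_epic A1 A2 B (f g : A1 ∨ A2 ⊢ B) :
  (forall i, f ∘ check_k i ≡ g ∘ check_k i) -> f ≡ g.
Proof.
have eta (h : A1 ∨ A2 ⊢ B) :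
    h ≡ copair (h ∘ check_k1 A1 A2) (h ∘ check_k2 A1 A2).
  by rewrite /copair bif_comp cat_assoc -nat_check_w -cat_assoc tri_check_w
             cat_idr.
move=> efg; rewrite (eta f) (eta g) /copair.
by rewrite (efg false : f ∘ check_k1 _ _ ≡ _) (efg true : f ∘ check_k2 _ _ ≡ _).
Qed.

Lemma initial_eq B (f g : Bot ⊢ B) : f ≡ g.
Proof. by rewrite -(initial f) -(initial g). Qed.

(** * Cut-free forms *)

(** Cut-freeness is defined by recursion on the two formulae rather than as an
    inductive family: inversion is then computation, and the formula indices of
    arrow terms never have to be unified.  The invertible rules, for a
    disjunction on the left and a conjunction on the right, are always applied
    first, as conditions on composites.

    Here the recursion is on the target; [L] gives the arrows that end with a
    rule acting on the source. *)
Fixpoint right_cut_free A (L : forall B, A ⊢ B -> Prop) B : A ⊢ B -> Prop :=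
  match B return A ⊢ B -> Prop with
  | Bin Conj B1 B2 => fun f => forall i, right_cut_free L (hat_k i ∘ f)
  | Bin Disj B1 B2 => fun f =>
      L _ f \/ exists i f', right_cut_free L f' /\ f ≡ @check_k i B1 B2 ∘ f'
  | B => L B
  end.

Definition axiom m B : Letter m ⊢ B -> Prop :=
  match B return Letter m ⊢ B -> Prop with
  | Letter n => fun f =>
      exists e : m = n, f ≡ ecast k (Letter m ⊢ Letter k) e (idt (Letter m))
  | _ => fun=> False
  end.

Fixpoint cut_free A : forall B, A ⊢ B -> Prop :=
  match A return forall B, A ⊢ B -> Prop with
  | Letter m => right_cut_free (@axiom m)
  | Bot => fun _ _ => True
  | Bin Conj A1 A2 => right_cut_free (fun B (f : A1 ∧ A2 ⊢ B) =>
      exists i (f' : pick i A1 A2 ⊢ B), cut_free f' /\ f ≡ f' ∘ hat_k i)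
  | Bin Disj A1 A2 => fun B f => forall i, cut_free (f ∘ @check_k i A1 A2)
  end.

Lemma right_cut_free_eqL A (L : forall B, A ⊢ B -> Prop) :
    (forall B (f g : A ⊢ B), f ≡ g -> L B f -> L B g) ->
  forall B (f g : A ⊢ B), f ≡ g -> right_cut_free L f -> right_cut_free L g.
Proof.
move=> Leq; elim=> [n | | [] B1 IH1 B2 IH2] f g efg /=; try exact: Leq.
  by move=> rf i; move: (rf i); case: i {rf}; [apply: IH2 | apply: IH1];
    rewrite efg.
case=> [Lf | [i [f' [rf' ef]]]]; first by left; apply: Leq Lf.
by right; exists i, f'; rewrite -efg.
Qed.

Lemma axiom_eqL m B (f g : Letter m ⊢ B) : f ≡ g -> axiom f -> axiom g.
Proof.
by case: B f g => //= n f g efg [e ef]; exists e; rewrite -efg.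
Qed.

Lemma cut_free_eqL A B (f g : A ⊢ B) : f ≡ g -> cut_free f -> cut_free g.
Proof.
elim: A B f g => [m | | [] A1 IH1 A2 IH2] B f g efg //=.
- by apply: right_cut_free_eqL efg; apply: axiom_eqL.
- apply: right_cut_free_eqL efg => {}B {}f {}g efg [i [f' [nf' ef]]].
  by exists i, f'; rewrite -efg.
- by move=> nf i; move: (nf i); case: i {nf}; [apply: IH2 | apply: IH1];
    rewrite efg.
Qed.

(** The source takes precedence in the definition of [cut_free], so a disjunctive
    source has to be passed through before the target is seen; the same holds of
    [cut_free_unpair] and [cut_free_check_k]. *)
Lemma cut_free_pair A B1 B2 (f : A ⊢ B1 ∧ B2) :
  (forall i, cut_free (hat_k i ∘ f)) -> cut_free f.
Proof.
elim: A f => [m | | [] A1 IH1 A2 IH2] f //= nf i.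
have nfi j : cut_free ((hat_k j ∘ f) ∘ check_k i) by apply: nf.
by case: i nfi {nf} => nf; [apply: IH2 | apply: IH1] => j;
  apply: cut_free_eqL (nf j); rewrite -cat_assoc.
Qed.

Lemma cut_free_unpair A B1 B2 (f : A ⊢ B1 ∧ B2) i :
  cut_free f -> cut_free (hat_k i ∘ f).
Proof.
elim: A f => [m | | [] A1 IH1 A2 IH2] f //= nf; try exact: nf.
move=> j; suff: cut_free (hat_k i ∘ (f ∘ check_k j)).
  by apply: cut_free_eqL; rewrite cat_assoc.
by move: (nf j); case: j {nf}; [apply: IH2 | apply: IH1].
Qed.

Lemma cut_free_hat_k i A1 A2 B (f : pick i A1 A2 ⊢ B) :
  cut_free f -> cut_free (f ∘ hat_k i).
Proof.
elim: B f => [n | | [] B1 IH1 B2 IH2] f nf.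
- by exists i, f.
- by exists i, f.
- apply: cut_free_pair => j; have := cut_free_unpair j nf.
  case: j => nfj; [apply: cut_free_eqL (IH2 _ nfj) | apply: cut_free_eqL (IH1 _ nfj)];
  by rewrite cat_assoc.
- by left; exists i, f.
Qed.

Lemma cut_free_check_k i A B1 B2 (f : A ⊢ pick i B1 B2) :
  cut_free f -> cut_free (check_k i ∘ f).
Proof.
elim: A f => [m | | [] A1 IH1 A2 IH2] f nf //.
- by right; exists i, f.
- by right; exists i, f.
- move=> j; suff: cut_free (check_k i ∘ (f ∘ check_k j)).
    by apply: cut_free_eqL; rewrite cat_assoc.
  by move: (nf j); case: j {nf}; [apply: IH2 | apply: IH1].
Qed.

Lemma cut_free_idt A : cut_free (idt A).
Proof.
elim: A => [m | | [] A1 IH1 A2 IH2] //.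
- by exists erefl.
- apply: cut_free_pair => i.
  apply: (@cut_free_eqL _ _ (idt _ ∘ hat_k i)); first by rewrite cat_idl cat_idr.
  by apply: cut_free_hat_k; case: i.
- move=> i; apply: (@cut_free_eqL _ _ (check_k i ∘ idt _)).
    by rewrite cat_idl cat_idr.
  by apply: cut_free_check_k; case: i.
Qed.

(** The last rule of the first factor, when it acts on the source, permutes with
    the cut; it remains to treat the first factors whose last rule introduces
    the cut formula. *)
Lemma cut_free_comp_left B C (g : B ⊢ C) :
    (forall m (f : Letter m ⊢ B), cut_free f -> cut_free (g ∘ f)) ->
    (forall A1 A2 (f : A1 ∧ A2 ⊢ B), cut_free f ->
       cut_free (g ∘ f) \/
       exists i (f' : pick i A1 A2 ⊢ B), cut_free f' /\ f ≡ f' ∘ hat_k i) ->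
  forall A (f : A ⊢ B), cut_free f -> cut_free (g ∘ f).
Proof.
move=> cut_letter cut_conj.
elim=> [m | | [] A1 IH1 A2 IH2] f nf //; first exact: cut_letter.
- case: (cut_conj _ _ f nf) => // [[i [f' [nf' ef]]]].
  have {IH1 IH2 nf'} ngf' : cut_free (g ∘ f').
    by case: i f' nf' {ef}; [apply: IH2 | apply: IH1].
  by apply: cut_free_eqL (cut_free_hat_k ngf'); rewrite ef cat_assoc.
- move=> i; apply: (@cut_free_eqL _ _ (g ∘ (f ∘ check_k i))).
    by rewrite cat_assoc.
  by move: (nf i); case: i {nf}; [apply: IH2 | apply: IH1].
Qed.

(** By induction on the cut formula.  If it is a conjunction, its two components
    are available in [f], and the cut moves up through [g] until [g] projects
    one of them out; if it is a disjunction, the roles are exchanged. *)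
Lemma cut_free_comp A B C (g : B ⊢ C) (f : A ⊢ B) :
  cut_free g -> cut_free f -> cut_free (g ∘ f).
Proof.
elim: B A C g f => [n | | [] B1 IHB1 B2 IHB2] A C g f ng.
- apply: cut_free_comp_left f => [m f /= [e] | A1 A2 f]; last by right.
  case: n / e f g ng => f g ng /= ef.
  by apply: cut_free_eqL ng; rewrite ef cat_idr.
- by apply: cut_free_comp_left f => // A1 A2 f; right.
- move=> nf; have {nf} nf i : cut_free (hat_k i ∘ f) by apply: cut_free_unpair.
  have cut_proj C' (h : B1 ∧ B2 ⊢ C') i (g' : pick i B1 B2 ⊢ C') :
      cut_free g' -> h ≡ g' ∘ hat_k i -> cut_free (h ∘ f).
    move=> ng' eh; apply: (@cut_free_eqL _ _ (g' ∘ (hat_k i ∘ f))).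
      by rewrite eh cat_assoc.
    by case: i g' ng' {eh} (nf i) => g' ng' nfi; [apply: IHB2 | apply: IHB1].
  elim: C g ng => [p | | [] C1 IH1 C2 IH2] g.
  + by case=> i [g' [ng' eg]]; apply: cut_proj eg.
  + by case=> i [g' [ng' eg]]; apply: cut_proj eg.
  + move=> ng; apply: cut_free_pair => i.
    apply: (@cut_free_eqL _ _ ((hat_k i ∘ g) ∘ f)); first by rewrite cat_assoc.
    by move: (ng i); case: i {ng}; [apply: IH2 | apply: IH1].
  + case=> [[i [g' [ng' eg]]] | [i [g' [ng' eg]]]]; first exact: cut_proj eg.
    apply: (@cut_free_eqL _ _ (check_k i ∘ (g' ∘ f))).
      by rewrite eg cat_assoc.
    apply: cut_free_check_k.
    by case: i g' ng' {eg}; [apply: IH2 | apply: IH1].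
- have cut_inj A' (f' : A' ⊢ B1 ∨ B2) i (h : A' ⊢ pick i B1 B2) :
      cut_free h -> f' ≡ check_k i ∘ h -> cut_free (g ∘ f').
    move=> nh ef; apply: (@cut_free_eqL _ _ ((g ∘ check_k i) ∘ h)).
      by rewrite ef cat_assoc.
    by case: i h nh (ng i) {ef} => h nh ngi; [apply: IHB2 | apply: IHB1].
  apply: cut_free_comp_left f => [m f | A1 A2 f].
    by case=> // [[i [h [nh ef]]]]; apply: cut_inj ef.
  case=> [? | [i [h [nh ef]]]]; first by right.
  by left; apply: cut_inj ef.
Qed.

Theorem cut_elimination A B (f : A ⊢ B) : cut_free f.
Proof.
have nproj i A1 A2 : cut_free (@hat_k i A1 A2).
  apply: (@cut_free_eqL _ _ (idt _ ∘ hat_k i)); first by rewrite cat_idl.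
  exact/cut_free_hat_k/cut_free_idt.
have ninj i A1 A2 : cut_free (@check_k i A1 A2).
  apply: (@cut_free_eqL _ _ (check_k i ∘ idt _)); first by rewrite cat_idr.
  exact/cut_free_check_k/cut_free_idt.
elim: {A B} f => [A | A | A | A1 A2 | A1 A2 | A1 A2 | A1 A2 | A
  | A B C g ng f nf | [] A1 A2 B1 B2 f1 nf1 f2 nf2].
- exact: cut_free_idt.
- by apply: cut_free_pair => -[]; apply: cut_free_eqL (cut_free_idt A);
    rewrite /= ?tri_hat_k1 ?tri_hat_k2.
- by case; apply: (cut_free_eqL _ (cut_free_idt A));
    rewrite /= ?tri_check_k1 ?tri_check_k2.
- exact: (nproj false).
- exact: (nproj true).
- exact: (ninj false).
- exact: (ninj true).
- by [].
- exact: cut_free_comp.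
- apply: cut_free_pair => -[].
    apply: (@cut_free_eqL _ _ (f2 ∘ hat_k true)); first exact: nat_hat_k2.
    exact: (@cut_free_hat_k true).
  apply: (@cut_free_eqL _ _ (f1 ∘ hat_k false)); first exact: nat_hat_k1.
  exact: (@cut_free_hat_k false).
- case.
    apply: (@cut_free_eqL _ _ (check_k true ∘ f2)).
      by symmetry; exact: nat_check_k2.
    exact: (@cut_free_check_k true).
  apply: (@cut_free_eqL _ _ (check_k false ∘ f1)).
    by symmetry; exact: nat_check_k1.
  exact: (@cut_free_check_k false).
Qed.

(** * The relation of an arrow, on addresses of letter occurrences *)

(** An address is a path from the root of the formula to a letter.  With
    addresses in place of numbers, the two sides of a connective are told apart
    by constructors instead of arithmetic. *)
Fixpoint pos A : Type :=
  match A with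
  | Letter _ => unit
  | Bot => Empty_set
  | Bin _ A1 A2 => (pos A1 + pos A2)%type
  end.

Fixpoint rel A B (f : A ⊢ B) : pos A -> pos B -> Prop :=
  match f in A ⊢ B return pos A -> pos B -> Prop with
  | idt A => fun x y => x = y
  | hat_w A => fun x y => match y with inl y | inr y => x = y end
  | check_w A => fun x y => match x with inl x | inr x => x = y end
  | hat_k1 A1 A2 => fun x y => if x is inl x then x = y else False
  | hat_k2 A1 A2 => fun x y => if x is inr x then x = y else False
  | check_k1 A1 A2 => fun x y => if y is inl y then x = y else False
  | check_k2 A1 A2 => fun x y => if y is inr y then x = y else False
  | check_kappa A => fun _ _ => False
  | compt A B C g f => fun x z => exists y, rel f x y /\ rel g y z
  | bint xi A1 A2 B1 B2 f1 f2 => fun x y =>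
      match x, y with
      | inl x, inl y => rel f1 x y
      | inr x, inr y => rel f2 x y
      | _, _ => False
      end
  end.

Definition rel_eq A B (f g : A ⊢ B) := forall x y, rel f x y <-> rel g x y.

Definition rel_empty A B (f : A ⊢ B) := forall x y, ~ rel f x y.

Lemma exists_sum X Y (P : X + Y -> Prop) :
  (exists z, P z) <-> (exists x, P (inl x)) \/ (exists y, P (inr y)).
Proof.
by split=> [[[x|y] p] | [[x p] | [y p]]]; [left | right | |]; eexists; exact: p.
Qed.

Lemma rel_sound A B (f g : A ⊢ B) : f ≡ g -> rel_eq f g.
Proof.
elim=> {A B f g}; rewrite /rel_eq /=.
all: try by [].
- by move=> A B f g _ IH x y; rewrite IH.
- by move=> A B f g h _ IH1 _ IH2 x y; rewrite IH1.
- move=> A B C g g' f f' _ IHg _ IHf x z.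
  by split=> -[y [/IHf fxy /IHg gyz]]; exists y.
- by move=> xi A1 A2 B1 B2 f1 f1' f2 f2' _ IH1 _ IH2 [x|x] [y|y].
all: intros; repeat match goal with
  | x : (_ + _)%type |- _ => destruct x
  | x : Empty_set |- _ => destruct x
  end; rewrite ?exists_sum /=; split; intros;
  repeat match goal with
  | H : ex _ |- _ => destruct H
  | H : _ /\ _ |- _ => destruct H
  | H : _ \/ _ |- _ => destruct H
  | H : inl _ = inl _ |- _ => injection H as H
  | H : inr _ = inr _ |- _ => injection H as H
  end; subst; try by [].
all: by eauto 7.
Qed.

Definition inj xi i A1 A2 : pos (pick i A1 A2) -> pos (Bin xi A1 A2) :=
  if i return pos (pick i A1 A2) -> pos (Bin xi A1 A2) then inr else inl.

Arguments inj {xi i A1 A2} x.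

Lemma inj_side xi A1 A2 i j (x : pos (pick i A1 A2)) (y : pos (pick j A1 A2)) :
  inj x = inj y :> pos (Bin xi A1 A2) -> i = j.
Proof. by case: i j x y => [] []. Qed.

Lemma inj_inj xi i A1 A2 : injective (@inj xi i A1 A2).
Proof. by case: i => x y []. Qed.

Lemma rel_hat_k i A1 A2 B (f : pick i A1 A2 ⊢ B) z y :
  rel (f ∘ hat_k i) z y <-> exists2 x, z = inj x & rel f x y.
Proof.
have projE x : rel (hat_k i) z x <-> z = inj x :> pos (A1 ∧ A2).
  by case: i x {f} => x; case: z => z //=; split=> [-> | []].
by split=> [[x [/projE]] | [x /projE]]; exists x.
Qed.

Lemma rel_check_k i A B1 B2 (f : A ⊢ pick i B1 B2) x z :
  rel (check_k i ∘ f) x z <-> exists2 y, z = inj y & rel f x y.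
Proof.
have injE y : rel (check_k i) y z <-> z = inj y :> pos (B1 ∨ B2).
  by case: i y {f} => y; case: z => z //=; split=> [-> | []].
by split=> [[y [fxy /injE]] | [y /injE]]; exists y.
Qed.

Lemma rel_hat_k_inj i A1 A2 B (f : pick i A1 A2 ⊢ B) x y :
  rel (f ∘ hat_k i) (inj x) y <-> rel f x y.
Proof.
by rewrite rel_hat_k; split=> [[x' /inj_inj ->] | fxy]; last exists x.
Qed.

Lemma rel_check_k_inj i A B1 B2 (f : A ⊢ pick i B1 B2) x y :
  rel (check_k i ∘ f) x (inj y) <-> rel f x y.
Proof.
by rewrite rel_check_k; split=> [[y' /inj_inj ->] | fxy]; last exists y.
Qed.

(** * Arrows with an empty relation *)

(** From A1 ∧ A2, an arrow through A1 and one through A2 are the two projections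
    of Bot ∧ Bot after the same arrow, hence equal. *)
Lemma bot_subterminal A (f g : A ⊢ Bot) : f ≡ g.
Proof.
elim: A f g => [m | | [] A1 IH1 A2 IH2] f g.
- by case: (cut_elimination f).
- exact: initial_eq.
- have mixed (f1 : A1 ⊢ Bot) (f2 : A2 ⊢ Bot) :
      f1 ∘ hat_k false ≡ f2 ∘ hat_k true.
    by rewrite /= (nat_hat_k1 f1 f2) (nat_hat_k2 f1 f2) hat_k_bot.
  case: (cut_elimination f) (cut_elimination g) => i [f' [_ ->]] [j [g' [_ ->]]].
  case: i j f' g' => [] [] f' g'.
  + by rewrite (IH2 f' g').
  + by symmetry; apply: mixed.
  + exact: mixed.
  + by rewrite (IH1 f' g').
- by apply: check_k_epic => -[]; [apply: IH2 | apply: IH1].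
Qed.

(** Every rule but the letter identity reflects emptiness to its premises.  For a
    pair, the two components factor through Bot by arrows that are equal because
    Bot is subterminal, so the pair factors through their common value. *)
Lemma empty_factors A B (f : A ⊢ B) :
  rel_empty f -> exists h : A ⊢ Bot, f ≡ check_kappa B ∘ h.
Proof.
have right_step A0 (L : forall C, A0 ⊢ C -> Prop) :
    (forall C (k : A0 ⊢ C), right_cut_free L k) ->
    (forall C (k : A0 ⊢ C), L C k -> rel_empty k ->
       exists h, k ≡ check_kappa C ∘ h) ->
  forall C (k : A0 ⊢ C), rel_empty k -> exists h, k ≡ check_kappa C ∘ h.
  move=> nf Lempty; elim=> [n | | [] C1 IH1 C2 IH2] k ek.
  - exact: Lempty (nf _ k) ek.
  - by exists k; rewrite (initial_eq (check_kappa Bot) (idt Bot)) cat_idl.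
  - have eki i : rel_empty (hat_k i ∘ k) by move=> x y [z [/ek]].
    have [h1 ek1] := IH1 _ (eki false); have [h2 ek2] := IH2 _ (eki true).
    exists h1; apply: hat_k_monic => i; rewrite cat_assoc.
    rewrite (initial_eq (hat_k i ∘ check_kappa _) (check_kappa _)).
    by case: i; [rewrite ek2 (bot_subterminal h2 h1) | rewrite ek1].
  - case: (nf _ k) => [Lk | [i [k' [_ ekk']]]]; first exact: Lempty Lk ek.
    have {ek} : rel_empty k'.
      move=> x y kxy; apply: (ek x (inj y)).
      by apply/(rel_sound ekk'); rewrite rel_check_k_inj.
    move=> ek'; suff [h eh] : exists h, k' ≡ check_kappa _ ∘ h.
      by exists h; rewrite ekk' eh cat_assoc; apply: eqL_comp => //; apply: initial_eq.
    by case: i k' ek' {ekk'}; [apply: IH2 | apply: IH1].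
elim: A B f => [m | | [] A1 IH1 A2 IH2] B f.
- apply: right_step f; first by move=> C k; apply: cut_elimination.
  case=> //= n k [e ek] ek0; case: n / e k ek ek0 => k ek ek0.
  by case: (ek0 tt tt); apply/(rel_sound ek).
- by exists (idt Bot); rewrite cat_idr; apply: initial_eq.
- apply: right_step f; first by move=> C k; apply: cut_elimination.
  move=> C k [i [k' [_ ekk']]] ek.
  suff [h eh] : exists h, k' ≡ check_kappa _ ∘ h.
    by exists (h ∘ hat_k i); rewrite ekk' eh cat_assoc.
  have ek' : rel_empty k'.
    move=> x y kxy; apply: (ek (inj x) y).
    by apply/(rel_sound ekk'); rewrite rel_hat_k_inj.
  by case: i k' ek' {ekk'}; [apply: IH2 | apply: IH1].
- move=> ef; have efi i : rel_empty (f ∘ check_k i) by move=> x y [z [_ /ef]].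
  have [h1 ef1] := IH1 _ _ (efi false); have [h2 ef2] := IH2 _ _ (efi true).
  exists (copair h1 h2); apply: check_k_epic => i; rewrite -cat_assoc.
  by case: i; rewrite ?copair_k1 ?copair_k2.
Qed.

Lemma empty_unique A B (f g : A ⊢ B) : rel_empty f -> rel_empty g -> f ≡ g.
Proof.
move=> /empty_factors[h ->] /empty_factors[h' ->].
by rewrite (bot_subterminal h h').
Qed.

(** If the last rule injects into the other disjunct, the arrow is empty, so it
    factors through Bot, and Bot maps into the required disjunct as well. *)
Lemma factors_through_injection i A B1 B2 (f : A ⊢ B1 ∨ B2) :
    (forall x y, rel f x y -> exists y' : pos (pick i B1 B2), y = inj y') ->
  exists h, f ≡ check_k i ∘ h.
Proof.
have right_case A0 (k : A0 ⊢ B1 ∨ B2) j k' :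
    k ≡ check_k j ∘ k' ->
    (forall x y, rel k x y -> exists y' : pos (pick i B1 B2), y = inj y') ->
  exists h, k ≡ check_k i ∘ h.
  case: (eqVneq i j) k' => [<- k' ek _ | neij k' ek ki]; first by exists k'.
  have /empty_factors[h eh] : rel_empty k'.
    move=> x y kxy; have /ki[y'] : rel k x (inj y).
      by apply/(rel_sound ek); rewrite rel_check_k_inj.
    by move/inj_side/esym/eqP; rewrite (negPf neij).
  exists (check_kappa _ ∘ h); rewrite ek eh !cat_assoc.
  by rewrite (initial_eq (check_k j ∘ _) (check_k i ∘ check_kappa _)).
elim: A f => [m | | [] A1 IH1 A2 IH2] f fi.
- by case: (cut_elimination f) => // -[j [f' [_ ef]]]; apply: right_case ef fi.
- by exists (check_kappa _); apply: initial_eq.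
- case: (cut_elimination f) => -[j [f' [_ ef]]]; last exact: right_case ef fi.
  suff [h eh] : exists h, f' ≡ check_k i ∘ h.
    by exists (h ∘ hat_k j); rewrite ef eh cat_assoc.
  have fi' x y : rel f' x y -> exists y' : pos (pick i B1 B2), y = inj y'.
    move=> fxy; apply: (fi (inj x)).
    by apply/(rel_sound ef); rewrite rel_hat_k_inj.
  by case: j f' fi' {ef}; [apply: IH2 | apply: IH1].
- have fij j x y :
      rel (f ∘ check_k j) x y -> exists y' : pos (pick i B1 B2), y = inj y'.
    by case=> z [_ /fi].
  have [h1 ef1] := IH1 _ (fij false); have [h2 ef2] := IH2 _ (fij true).
  exists (copair h1 h2); apply: check_k_epic => j; rewrite -cat_assoc.
  by case: j; rewrite ?copair_k1 ?copair_k2.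
Qed.

(** * Coherence *)

(** The part of the induction that treats the target, common to the sources that
    are letters and those that are conjunctions. *)
Lemma coherence_right A (L : forall B, A ⊢ B -> Prop) :
    (forall B (f : A ⊢ B), right_cut_free L f) ->
    (forall B (f g : A ⊢ B), L B f -> L B g -> rel_eq f g -> f ≡ g) ->
  forall B (f g : A ⊢ B), rel_eq f g -> f ≡ g.
Proof.
move=> nf Lcoh; elim=> [n | | [] B1 IH1 B2 IH2] f g efg.
- exact: Lcoh (nf _ f) (nf _ g) efg.
- exact: bot_subterminal.
- apply: hat_k_monic => i.
  have {}efg : rel_eq (hat_k i ∘ f) (hat_k i ∘ g).
    by move=> x z; split=> -[y [/efg fxy yz]]; exists y.
  by case: i efg; [apply: IH2 | apply: IH1].
- have right_case (k l : A ⊢ B1 ∨ B2) i k' :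
      k ≡ check_k i ∘ k' -> rel_eq k l -> k ≡ l.
    move=> ek ekl; have [l' el] : exists l', l ≡ check_k i ∘ l'.
      apply: factors_through_injection => x y /ekl/(rel_sound ek).
      by rewrite rel_check_k => -[y' -> _]; exists y'.
    have ekl' : rel_eq k' l'.
      move=> x y; rewrite -rel_check_k_inj -[rel l' _ _]rel_check_k_inj.
      by rewrite -(rel_sound ek x (inj y)) -(rel_sound el x (inj y)).
    rewrite ek el; suff -> : k' ≡ l' by [].
    by case: i k' l' ekl' {ek el}; [apply: IH2 | apply: IH1].
  case: (nf _ f) => [Lf | [i [f' [_ ef]]]]; last exact: right_case ef efg.
  case: (nf _ g) => [Lg | [i [g' [_ eg]]]]; first exact: Lcoh.
  by symmetry; apply: right_case eg _ => x y; rewrite efg.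
Qed.

Theorem rel_faithful A B (f g : A ⊢ B) : rel_eq f g -> f ≡ g.
Proof.
elim: A B f g => [m | | [] A1 IH1 A2 IH2] B f g.
- apply: coherence_right f g; first by move=> B' f; apply: cut_elimination.
  case=> // n {}f {}g [e ef] [e' eg] _.
  by rewrite ef eg (eq_irrelevance e e').
- by move=> _; apply: initial_eq.
- apply: coherence_right f g; first by move=> B' f; apply: cut_elimination.
  move=> {}B f g [i [f' [_ ef]]] [j [g' [_ eg]]] efg.
  (* Different projections would give f and g disjoint relations. *)
  case: (eqVneq i j) g' eg => [<- g' eg | neij g' eg].
    have efg' : rel_eq f' g'.
      move=> x y; rewrite -rel_hat_k_inj -[rel g' _ _]rel_hat_k_inj.
      by rewrite -(rel_sound ef (inj x) y) -(rel_sound eg (inj x) y).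
    rewrite ef eg; suff -> : f' ≡ g' by [].
    by case: i f' g' efg' {ef eg}; [apply: IH2 | apply: IH1].
  have disjoint x y : rel f x y -> rel g x y -> False.
    move/(rel_sound ef); rewrite rel_hat_k => -[z -> _].
    move/(rel_sound eg); rewrite rel_hat_k => -[t /inj_side/eqP].
    by rewrite (negPf neij).
  by apply: empty_unique => x y r; apply: (disjoint x y) => //; apply/efg.
- move=> efg; apply: check_k_epic => i.
  have {}efg : rel_eq (f ∘ check_k i) (g ∘ check_k i).
    by move=> x z; split=> -[y [xy /efg fyz]]; exists y.
  by case: i efg; [apply: IH2 | apply: IH1].
Qed.

(** * Addresses and the numbering of letter occurrences *)

Fixpoint occ_of A : pos A -> occ (Gobj A) :=
  match A return pos A -> occ (Gobj A) with
  | Letter _ => fun=> ord0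
  | Bot => fun x => match x with end
  | Bin _ A1 A2 => fun x =>
      match x with
      | inl x => lshift (letters (Gobj A2)) (occ_of x)
      | inr x => rshift (letters (Gobj A1)) (occ_of x)
      end
  end.

Lemma occ_of_inj A : injective (@occ_of A).
Proof.
elim: A => [m [] [] | [] | xi A1 IH1 A2 IH2 [x|x] [y|y]] //= /eqP.
- by rewrite eq_lshift => /eqP/IH1 ->.
- by rewrite eq_lrshift.
- by rewrite eq_rlshift.
- by rewrite eq_rshift => /eqP/IH2 ->.
Qed.

Lemma occ_of_surj A (i : occ (Gobj A)) : exists x, occ_of x = i.
Proof.
elim: A i => [m i | [] | xi A1 IH1 A2 IH2 i] //=.
  by exists tt; rewrite ord1.
rewrite -(splitK i); case: (split i) => j.
  by have [x <-] := IH1 j; exists (inl x).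
by have [x <-] := IH2 j; exists (inr x).
Qed.

Lemma mem_G A B (f : A ⊢ B) x y : (occ_of x, occ_of y) \in G f <-> rel f x y.
Proof.
have eq_occ C (u v : pos C) : occ_of u = occ_of v :> nat <-> u = v.
  by split=> [/val_inj/occ_of_inj | ->].
elim: A B / f x y => [A | A | A | A1 A2 | A1 A2 | A1 A2 | A1 A2 | A
  | A B C g IHg f IHf | xi A1 A2 B1 B2 f1 IH1 f2 IH2] x y;
  rewrite /= inE /=.
- by split=> [/eqP/occ_of_inj | ->].
- by case: y => y; rewrite /= ?modnDl !modn_small // -eq_occ; split=> /eqP.
- by case: x => x; rewrite /= ?modnDl !modn_small // -eq_occ; split=> /eqP.
- case: x => x /=; first by rewrite -eq_occ; split=> /eqP.
  by split=> // /eqP e; have := ltn_ord (occ_of y); rewrite -e ltnNge leq_addr.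
- case: x => x /=; last by rewrite addnC eqn_add2r -eq_occ; split=> /eqP.
  by split=> // /eqP e; have := ltn_ord (occ_of x); rewrite e ltnNge leq_addl.
- case: y => y /=; first by rewrite eq_sym -eq_occ; split=> /eqP.
  by split=> // /eqP e; have := ltn_ord (occ_of x); rewrite -e ltnNge leq_addr.
- case: y => y /=; last by rewrite eq_sym addnC eqn_add2l -eq_occ; split=> /eqP.
  by split=> // /eqP e; have := ltn_ord (occ_of y); rewrite e ltnNge leq_addl.
- by [].
- split=> [/existsP[k] | [z [/IHf xz /IHg zy]]].
    by have [z <-] := occ_of_surj k; case/andP=> /IHf xz /IHg zy; exists z.
  by apply/existsP; exists (occ_of z); rewrite xz.
- split=> [/orP[] /imsetP[[k l]] | ].
  + have [z <-] := occ_of_surj k; have [t <-] := occ_of_surj l.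
    move=> /IH1 zt [ex ey]; have -> : x = inl z by exact: occ_of_inj.
    by have -> : y = inl t by exact: occ_of_inj.
  + have [z <-] := occ_of_surj k; have [t <-] := occ_of_surj l.
    move=> /IH2 zt [ex ey]; have -> : x = inr z by exact: occ_of_inj.
    by have -> : y = inr t by exact: occ_of_inj.
  + case: x y => x [] y //= => [/IH1 | /IH2] xy; apply/orP; [left | right].
      by apply/imsetP; exists (occ_of x, occ_of y).
    by apply/imsetP; exists (occ_of x, occ_of y).
Qed.

Theorem mainTheorem7 (A B : formula) (f g : A ⊢ B) : G f = G g -> f ≡ g.
Proof.
by move=> eG; apply: rel_faithful => x y; rewrite -!mem_G eG.
Qed.
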